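(* Let $\mathbf{K}\in\mathbb{R}^{p\times p}$ be the matrix representing, in a 2D wavelet basis $\{\psi_I\}_{I=1}^p$, an operator $A^*A$ with $$\mathbf{K}_{I,I'}=(A^*A\psi_I,\psi_{I'})_X=\int_{\mathbb{R}^2}\int_{\mathbb{R}^2}K(x,x')\psi_I(x)\psi_{I'}(x')\,dx\,dx',\qquad K(x,x')=K(x-x').$$ For $w\in\mathbb{R}^p$, let $w_j^{(t)}$ be the vector of the wavelet components of $w$ related to basis functions of scale $j$ and type $(t)$. Let $\mathbf{K}_{j\to j'}^{(t)\to(t')}$ denote the block of $\mathbf{K}$ corresponding to the $j,(t)$ subset of the column indices and the $j',(t')$ subset of the row indices. Then (identifying vectors of length $2^{2j'}$ with $2^{j'}\times2^{j'}$ matrices) $$\mathbf{K}_{j\to j'}^{(t)\to(t')}w_j^{(t)}=\begin{cases}\widetilde{\mathbf{K}}_{j\to j'}^{(t)\to(t')}\ast\mathscr{U}^{\delta}(W_j^{(t)}) & \text{if } j<j',\\[2pt] \widetilde{\mathbf{K}}_{j\to j'}^{(t)\to(t')}\ast W_j^{(t)} & \text{if } j=j',\\[2pt] \mathscr{D}^{\delta}\big(\widetilde{\mathbf{K}}_{j\to j'}^{(t)\to(t')}\ast W_j^{(t)}\big) & \text{if } j>j',\end{cases}$$ where $\delta=|j'-j|$ and, with $\hat j=\max(j,j')$, $\widetilde{\mathbf{K}}_{j\to j'}^{(t)\to(t')}\in\mathbb{R}^{(2^{\hat j+1}-1)\times(2^{\hat j+1}-1)}$ is given by $$\Big[\widetilde{\mathbf{K}}_{j\to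 j'}^{(t)\to(t')}\Big]_d=\int_{\mathbb{R}^2}\int_{\mathbb{R}^2}K(x-x'-2^{-\hat j}d)\,\psi_{j',0}^{(t')}(x')\,\psi_{j,0}^{(t)}(x)\,dx\,dx',$$ $d=(d_1,d_2)$, $d_1,d_2\in\{-2^{\hat j}+1,\ldots,0,\ldots,2^{\hat j}-1\}$. Here $W_j^{(t)}\in\mathbb{R}^{2^j\times2^j}$ is obtained by reshaping $w_j^{(t)}\in\mathbb{R}^{2^{2j}}$ so that $[W_j^{(t)}]_d$ is the component $w_I$ whose index $I$ is identified by $(j,(t),d)$.
   Context: $X=L^2(\Omega)$ with $\Omega\subset\mathbb{R}^2$ (e.g. $\Omega=[0,1]^2$), and $A:X\to Y$ is a bounded linear operator into a Hilbert space $Y$. Wavelet basis: $\psi,\phi$ are real functions (mother wavelet and scaling function) supported in $[0,1]$. Set $\psi^{(v)}(x_1,x_2)=\phi(x_1)\psi(x_2)$, $\psi^{(h)}(x_1,x_2)=\psi(x_1)\phi(x_2)$, $\psi^{(d)}(x_1,x_2)=\psi(x_1)\psi(x_2)$, $\psi^{(f)}(x_1,x_2)=\phi(x_1)\phi(x_2)$, and $\psi_{j,k}^{(t)}(x)=2^j\psi^{(t)}(2^jx-k)$ for $j\in\mathbb{N}_0$, $k\in\mathbb{N}_0^2$. For integers $J_0<J$, the orthonormal family $\{\psi_I\}_{I=1}^p$, $p=2^{2J}$, consists of the $\psi_{j,k}^{(t)}$ with scales $j\in\{J_0,\ldots,J-1\}$, types $(t)\in\{(v),(h),(d)\}$ for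 every $j$ and additionally $(f)$ for $j=J_0$, and offsets $k=(k_1,k_2)$ with $k_1,k_2\in\{0,\ldots,2^j-1\}$. Each index $I$ is identified with a triple $(j,(t),k)$. Discrete convolution: for $B\in\mathbb{R}^{b\times b}$ and $C\in\mathbb{R}^{(2b-1)\times(2b-1)}$ with entries of $C$ indexed by $\{-b+1,\ldots,b-1\}^2$, $C\ast B\in\mathbb{R}^{b\times b}$ is $(C\ast B)_{k,l}=\sum_{i=0}^{b-1}\sum_{j=0}^{b-1}C_{k-i,l-j}B_{i,j}$. Upsampling: for $B\in\mathbb{R}^{b\times b}$, $\mathscr{U}(B)\in\mathbb{R}^{2b\times2b}$ has entries $\mathscr{U}(B)_{2k,2l}=B_{k,l}$ for $k,l=0,\ldots,b-1$ and all other entries $0$. Downsampling: for $B\in\mathbb{R}^{2b\times2b}$, $\mathscr{D}(B)\in\mathbb{R}^{b\times b}$, $\mathscr{D}(B)_{k,l}=B_{2k,2l}$. $\mathscr{U}^\eta,\mathscr{D}^\eta$ denote $\eta$-fold iterated application. *)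

(* Defs.v *)
From HB Require Import structures.
From mathcomp Require Import all_boot all_order all_algebra.
From mathcomp Require Import all_classical all_reals all_analysis.

Set Implicit Arguments.
Unset Strict Implicit.
Unset Printing Implicit Defensive.
Import Order.TTheory GRing.Theory Num.Theory.
Import numFieldNormedType.Exports.

Local Open Scope classical_set_scope.
Local Open Scope ring_scope.

(* R^2 as a measurable type (same carrier as R * R, Borel sigma-algebra) and its
   Lebesgue measure. *)
Notation plane R := (measurableTypeR R * measurableTypeR R)%type.
Notation leb2 R := (@lebesgue_measure R \x @lebesgue_measure R)%E.

(* L^2(Omega), Omega measurable: measurable real functions that are square
   integrable for Lebesgue measure restricted to Omega.  LfunType is the space
   of functions and not its quotient by equality almost everywhere (the
   library has no vector space structure on the quotient); hence the L2
   pairing and seminorm below vanish on functions that are null a.e. on Omega,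
   and a linear map which is bounded for the seminorm is constant on classes. *)
Section L2.
Variables (R : realType) (Omega : set (plane R)) (mOmega : measurable Omega).

Definition L2 := LfunType (mrestr (leb2 R) mOmega) (lee1n 2 : (1 <= 2%:E :> \bar R)%E).

Definition L2dot (f g : L2) : R := \int[leb2 R]_(x in Omega) (f x * g x).

Definition L2norm (f : L2) : R :=
  fine ('N[mrestr (leb2 R) mOmega]_2%:E [EFin \o f])%E.

Variable (Y : completeNormedModType R).

Definition bounded_op (A : L2 -> Y) := exists C : R, forall f, `|A f| <= C * L2norm f.

(* Astar y is a representative of the class of the adjoint at y. *)
Definition adjoint_op (dotY : Y -> Y -> R) (A : L2 -> Y) (Astar : Y -> L2) :=
  forall f y, dotY (A f) y = L2dot f (Astar y).

End L2.

(* The types (v), (h), (d), (f). *)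
Variant wtype := Vert | Horz | Diag | Father.

Definition wavelet_valid (J0 J j : nat) (t : wtype) : bool :=
  if t is Father then j == J0 else (J0 <= j < J)%N.

Record windex (J0 J : nat) := WIndex {
  wscale : nat;
  wkind : wtype;
  woffset : 'I_(2 ^ wscale) * 'I_(2 ^ wscale);
  wvalid : wavelet_valid J0 J wscale wkind }.

Section Wavelet.
Variables (R : realType) (phi psi : R -> R).

Definition mother2 (t : wtype) (x : R * R) : R :=
  match t with
  | Vert => phi x.1 * psi x.2
  | Horz => psi x.1 * phi x.2
  | Diag => psi x.1 * psi x.2
  | Father => phi x.1 * phi x.2
  end.

Definition wavelet (j : nat) (t : wtype) (k : nat * nat) (x : R * R) : R :=
  2 ^+ j * mother2 t (2 ^+ j * x.1 - k.1%:R, 2 ^+ j * x.2 - k.2%:R).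

Definition wavelet_at (J0 J : nat) (I : windex J0 J) : R * R -> R :=
  wavelet (wscale I) (wkind I)
    (nat_of_ord (woffset I).1, nat_of_ord (woffset I).2).

Definition dbl_int (G : R * R -> R * R -> R) (f g : R * R -> R) : R :=
  \int[leb2 R]_x' \int[leb2 R]_x (G x x' * f x * g x').

End Wavelet.

(* Position, among -b+1, ..., b-1, of the difference k - i; the position r
   stands for the integer r - (b - 1). *)
Lemma centred_sub_subproof b (k i : 'I_b) : (k + (b.-1 - i) < (2 * b).-1)%N.
Proof.
case: b k i => [|b] k i; first by case: k.
rewrite mul2n doubleS /= ltnS -addnn; apply: leq_add; last exact: leq_subr.
by rewrite -ltnS.
Qed.

Definition centred_sub b (k i : 'I_b) : 'I_((2 * b).-1) :=
  Ordinal (centred_sub_subproof k i).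

Definition centred_label (b r : nat) : int := r%:Z - (b.-1)%:Z.

Lemma centred_labelE b (k i : 'I_b) :
  centred_label b (centred_sub k i) = k%:Z - i%:Z.
Proof.
have ib : (i <= b.-1)%N by case: b k i => [|b] k i; [case: k | rewrite -ltnS].
by rewrite /centred_label /= PoszD -subzn // addrA addrAC addrK.
Qed.

Lemma half_ord_subproof b (k : 'I_(b.*2)) : (k./2 < b)%N.
Proof. by rewrite ltn_half_double. Qed.

Definition half_ord b (k : 'I_(b.*2)) : 'I_b := Ordinal (half_ord_subproof k).

Lemma double_ord_subproof b (k : 'I_b) : (k.*2 < b.*2)%N.
Proof. by rewrite ltn_double. Qed.

Definition double_ord b (k : 'I_b) : 'I_(b.*2) := Ordinal (double_ord_subproof k).

Section MatrixOps.
Variable R : realType.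

Definition mxconv b (C : 'M[R]_((2 * b).-1)) (B : 'M[R]_b) : 'M[R]_b :=
  \matrix_(k, l) \sum_(i < b) \sum_(j < b)
    C (centred_sub k i) (centred_sub l j) * B i j.

Definition upsample b (B : 'M[R]_b) : 'M[R]_(b.*2) :=
  \matrix_(k, l) if odd k || odd l then 0 else B (half_ord k) (half_ord l).

Definition downsample b (B : 'M[R]_(b.*2)) : 'M[R]_b :=
  \matrix_(k, l) B (double_ord k) (double_ord l).

Fixpoint upsample_iter eta b (B : 'M[R]_b) : 'M[R]_(iter eta double b) :=
  if eta is eta'.+1 then upsample (upsample_iter eta' B) else B.

Fixpoint downsample_iter eta b : 'M[R]_(iter eta double b) -> 'M[R]_b :=
  if eta is eta'.+1 then fun B => downsample_iter (downsample B) else id.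

Definition resize m n (e : m = n) (B : 'M[R]_m) : 'M[R]_n := castmx (e, e) B.

End MatrixOps.

Definition scale_gap (j j' : nat) : nat := `|j'%:Z - j%:Z|%N.

Lemma iter_double_expn eta j : iter eta double (2 ^ j)%N = (2 ^ (eta + j))%N.
Proof. by elim: eta => //= eta ->; rewrite -mul2n -expnS. Qed.

Lemma size_fine_col j j' : (j' <= j)%N -> (2 ^ j = 2 ^ maxn j j')%N.
Proof. by move=> /maxn_idPl ->. Qed.

Lemma size_fine_row j j' : (j <= j')%N -> (2 ^ maxn j j' = 2 ^ j')%N.
Proof. by move=> /maxn_idPr ->. Qed.

Lemma size_up j j' : (j < j')%N ->
  iter (scale_gap j j') double (2 ^ j)%N = (2 ^ maxn j j')%N.
Proof.
move=> /ltnW jj'; rewrite iter_double_expn /scale_gap (maxn_idPr jj').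
by rewrite subzn //= subnK.
Qed.

Lemma size_down j j' : (j' < j)%N ->
  (2 ^ maxn j j')%N = iter (scale_gap j j') double (2 ^ j')%N.
Proof.
move=> /ltnW jj'; rewrite iter_double_expn /scale_gap (maxn_idPl jj').
by rewrite distnC subzn //= subnK.
Qed.

(* Inverse of mxvec_index: row-major numbering of the offsets of one scale. *)
Definition grid_offset b (i : 'I_(b * b)) : 'I_b * 'I_b :=
  enum_val (cast_ord (esym (mxvec_cast b b)) i).

Lemma grid_offsetK b (k l : 'I_b) : grid_offset (mxvec_index k l) = (k, l).
Proof. by rewrite /grid_offset /mxvec_index cast_ordK enum_rankK. Qed.

Section Blocks.
Variables (R : realType) (J0 J : nat).
Variable idx : windex J0 J -> 'I_(2 ^ (2 * J)).

Definition block_idx j t (v : wavelet_valid J0 J j t) (i : 'I_(2 ^ j * 2 ^ j)) :=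
  idx (WIndex (grid_offset i) v).

(* Columns of scale j and type t, rows of scale j' and type t'. *)
Definition mxblock_to (K : 'M[R]_(2 ^ (2 * J))) j t (v : wavelet_valid J0 J j t)
    j' t' (v' : wavelet_valid J0 J j' t') : 'M[R]_(2 ^ j' * 2 ^ j', 2 ^ j * 2 ^ j) :=
  mxsub (block_idx v') (block_idx v) K.

Definition subvector (w : 'cV[R]_(2 ^ (2 * J))) j t (v : wavelet_valid J0 J j t) :
    'cV[R]_(2 ^ j * 2 ^ j) :=
  rowsub (block_idx v) w.

Definition reshaped (w : 'cV[R]_(2 ^ (2 * J))) j t (v : wavelet_valid J0 J j t) :
    'M[R]_(2 ^ j) :=
  \matrix_(d1, d2) w (idx (WIndex (d1, d2) v)) 0.

End Blocks.

Definition Ktilde (R : realType) (phi psi : R -> R) (kappa : R * R -> R)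
    (j : nat) (t : wtype) (j' : nat) (t' : wtype) :
    'M[R]_((2 * 2 ^ maxn j j').-1) :=
  let label r : R := (centred_label (2 ^ maxn j j') r)%:~R in
  \matrix_(r, s)
    \int[leb2 R]_x' \int[leb2 R]_x
      (kappa ((x : R * R) - (x' : R * R) - (2 ^- maxn j j' * label r, 2 ^- maxn j j' * label s))
       * wavelet phi psi j' t' (0, 0)%N x' * wavelet phi psi j t (0, 0)%N x).

(* Main.v *)
Require Import Defs.
From HB Require Import structures.
From mathcomp Require Import all_boot all_order all_algebra.
From mathcomp Require Import all_classical all_reals all_analysis.
From mathcomp Require Import measurable_realfun.
Import Order.TTheory GRing.Theory Num.Theory.
Import numFieldNormedType.Exports.

Set Implicit Arguments.
Unset Strict Implicit.
Unset Printing Implicit Defensive.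

Local Open Scope classical_set_scope.
Local Open Scope ring_scope.

(** A wavelet of scale j and offset k is the wavelet of offset 0 translated to
    the position 2^-j k, and the kernel depends only on x - x'.  Lebesgue
    measure on the plane being translation invariant, the double integral
    pairing two wavelets therefore depends only on the difference of their
    positions: it is the value of one function, [correlation], at
    2^-j' k' - 2^-j k ([dbl_int_wavelet]).  The self-adjointness of A^* A lets
    the two wavelets be attached to the variables x and x' in the order used
    by [Ktilde].

    [Ktilde] samples [correlation] on the grid of step 2^-N, N = max(j, j').
    Both positions lie on this grid: the one on the scale N has its own offset
    as label, the other one has its offset multiplied by 2^delta
    ([dyadic_pointB]).  Hence the block product at k' is
      sum over k of Ktilde_(k' - 2^delta k) W_k   if j < j',
      sum over k of Ktilde_(2^delta k' - k) W_k   if j > j',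
    and the same sum with delta = 0 if j = j'.  The first is the convolution
    with an upsampled W, whose only nonzero entries are at the multiples of
    2^delta ([sum_upsample_iter]); the second is a convolution sampled at the
    multiples of 2^delta ([downsample_iterE]). *)

(** * Translation invariance of the integral *)

Section MeasurePreserving.
Local Open Scope ereal_scope.
Import HBNNSimple.
Context d (T : measurableType d) (R : realType).
Variable mu : {measure set T -> \bar R}.
Implicit Types (f : T -> \bar R) (h : T -> T).

Definition measure_preserving h := measurable_fun setT h /\
  forall B, measurable B -> mu (h @^-1` B) = mu B.

Lemma sintegral_comp h (u v : {nnsfun T >-> R}) : measure_preserving h ->
  (forall x, v x = u (h x)) -> sintegral mu v = sintegral mu u.
Proof.
move=> [mh muh] vE; rewrite -!integralT_nnsfun.
under eq_integral do rewrite vE.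
rewrite -[LHS](@ge0_integral_pushforward _ _ _ _ _ h mh mu setT (EFin \o u))//.
- by apply: eq_measure_integral => B mB _; exact: muh.
- by apply/measurable_EFinP.
- by move=> x _; rewrite lee_fin.
Qed.

(** The integral of a nonnegative function is the supremum of the integrals of
    the simple functions below it, and composing with [h] sends a simple
    function below [f] to one below [f \o h] with the same integral. *)
Lemma ge0_integral_comp_ge h f : measure_preserving h ->
  (forall x, 0 <= f x) -> \int[mu]_x f (h x) >= \int[mu]_x f x.
Proof.
move=> ph f0; rewrite !ge0_integralTE//.
apply: ge_ereal_sup => _ [u /= uf <-].
have muh : measurable_fun setT (u \o h).
  by apply: measurableT_comp => //; exact: (proj1 ph).
have fuh : finite_set (range (u \o h)).
  by apply: (sub_finite_set _ (fimfunP u)) => _ [x _ <-]; exists (h x).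
have uh0 x : (0 <= (u \o h) x)%R by [].
pose v : {nnsfun T >-> R} := HB.pack (u \o h)
  (isMeasurableFun.Build _ _ _ _ _ muh) (FiniteImage.Build _ _ _ fuh)
  (isNonNegFun.Build _ _ _ uh0).
apply: ereal_sup_ubound; exists v => [x /=|]; first exact: uf.
exact: sintegral_comp ph _.
Qed.

(** For a nonnegative function, the two inequalities are the previous lemma for
    [h] and for its section [h'].  Since [f] is arbitrary, this applies to an
    iterated integral without discussing how the inner integral depends on the
    outer variable. *)
Lemma integral_comp h h' f : measure_preserving h ->
  measure_preserving h' -> cancel h' h ->
  \int[mu]_x f (h x) = \int[mu]_x f x.
Proof.
move=> ph ph' h'K.
have ge0 g : (forall x, 0 <= g x) -> \int[mu]_x g (h x) = \int[mu]_x g x.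
  move=> g0; apply/eqP; rewrite eq_le; apply/andP; split.
    have := @ge0_integral_comp_ge h' (g \o h) ph' (fun x => g0 (h x)).
    by under [X in _ <= X -> _]eq_integral do rewrite /= h'K.
  exact: ge0_integral_comp_ge.
rewrite integralE [RHS]integralE; congr (_ - _).
- rewrite -(ge0 _ (funepos_ge0 f)).
  by apply: eq_integral => x _; rewrite !funeposE.
- rewrite -(ge0 _ (funeneg_ge0 f)).
  by apply: eq_integral => x _; rewrite !funenegE.
Qed.

End MeasurePreserving.

Section Translation.
Context (R : realType).
Local Open Scope ereal_scope.

Lemma measurable_translation (a : R) :
  measurable_fun setT ((fun x => x + a)%R : measurableTypeR R -> measurableTypeR R).
Proof. exact: measurable_funD. Qed.

(** Both sides are measures that agree on half-open intervals, which determine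
    Lebesgue measure. *)
Lemma lebesgue_measure_translation (a : R) (B : set R) : measurable B ->
  lebesgue_measure ((fun x => x + a)%R @^-1` B) = lebesgue_measure B.
Proof.
move=> mB.
pose h : {mfun measurableTypeR R >-> measurableTypeR R} := HB.pack
  ((fun x => x + a)%R : measurableTypeR R -> measurableTypeR R)
  (isMeasurableFun.Build _ _ _ _ _ (measurable_translation a)).
rewrite (_ : lebesgue_measure _ = pushforward lebesgue_measure h B)//.
apply/esym/lebesgue_measure_unique => //= _ [[x y]] _ <-.
rewrite /pushforward /=.
have -> : (fun z : R => (z + a)%R) @^-1` `]x, y]%classic =
    `](x - a)%R, (y - a)%R]%classic.
  by apply/seteqP; split => z /=; rewrite !in_itv/= ltrBlDr lerBrDr.
rewrite !lebesgue_measure_itv/= !lte_fin ltrD2r.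
by case: ifP => // _; rewrite -!EFinB opprB addrA subrK.
Qed.

(** A product measure is determined by its values on rectangles, where the
    claim is translation invariance in each coordinate. *)
Lemma measure_preserving_translation (a : R * R) :
  measure_preserving (leb2 R) ((fun x : R * R => x + a)%R : plane R -> plane R).
Proof.
pose h := (fun x : R * R => x + a)%R : plane R -> plane R.
have mh : measurable_fun setT h.
  apply/measurable_fun_pairP; split.
  - exact: (@measurable_funD _ _ _ _ fst (cst a.1)).
  - exact: (@measurable_funD _ _ _ _ snd (cst a.2)).
split=> // B mB.
pose hm : {mfun plane R >-> plane R} :=
  HB.pack h (isMeasurableFun.Build _ _ _ _ _ mh).
rewrite -[LHS]/(pushforward (leb2 R) hm B).
apply/esym/product_measure_unique => //= A1 A2 mA1 mA2.
rewrite -(lebesgue_measure_translation a.1 mA1).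
rewrite -(lebesgue_measure_translation a.2 mA2).
rewrite -product_measure1E// -[X in measurable X]setTI;
  exact: measurable_translation.
Qed.

Lemma integral_translation (a : R * R) (f : plane R -> \bar R) :
  \int[leb2 R]_x f ((x : R * R) + a)%R = \int[leb2 R]_x f x.
Proof.
have ph := measure_preserving_translation a.
have ph' := measure_preserving_translation (- a)%R.
exact: (integral_comp f ph ph' (@subrK _ a)).
Qed.

Lemma Rintegral_translation (a : R * R) (f : plane R -> R) :
  (\int[leb2 R]_x f ((x : R * R) + a) = \int[leb2 R]_x f x)%R.
Proof. by congr fine; exact: (integral_translation a (EFin \o f)). Qed.

End Translation.

(** * The pairing of two wavelets through a convolution kernel *)

Section Correlation.
Variables (R : realType) (phi psi : R -> R) (kappa : R * R -> R).

Definition dyadic_point (j : nat) (k : nat * nat) : R * R :=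
  (2 ^- j * k.1%:R, 2 ^- j * k.2%:R).

(** The entries of [Ktilde] are samples of this function on the grid of the
    finer scale; the entries of a block of the operator matrix are its values
    at the differences of two wavelet positions. *)
Definition correlation j t j' t' (z : R * R) : R :=
  \int[leb2 R]_x' \int[leb2 R]_x
    (kappa ((x : R * R) - (x' : R * R) - z)
     * wavelet phi psi j' t' (0, 0)%N x' * wavelet phi psi j t (0, 0)%N x).

Lemma wavelet_shift j t k (x : R * R) :
  wavelet phi psi j t k (x + dyadic_point j k) = wavelet phi psi j t (0, 0)%N x.
Proof.
have e (a : R) m : 2 ^+ j * (a + 2 ^- j * m%:R) - m%:R = 2 ^+ j * a - 0%:R.
  by rewrite mulrDr mulVKf ?expf_neq0// addrK subr0.
by rewrite /wavelet /= !e.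
Qed.

(** Translating each variable by the position of its wavelet brings both
    wavelets to the origin; the kernel, which sees only [x - x'], absorbs the
    difference of the two positions. *)
Lemma dbl_int_wavelet j t k j' t' k' :
  dbl_int (fun x x' => kappa (x - x'))
    (wavelet phi psi j t k) (wavelet phi psi j' t' k') =
  correlation j t j' t' (dyadic_point j' k' - dyadic_point j k).
Proof.
rewrite /dbl_int -(Rintegral_translation (dyadic_point j' k')).
apply: eq_Rintegral => x' _; rewrite -(Rintegral_translation (dyadic_point j k)).
apply: eq_Rintegral => x _; rewrite !wavelet_shift mulrAC.
congr (kappa _ * _ * _).
by rewrite opprB opprD addrACA.
Qed.

(** The position of an offset on a scale is also the position, on every finer
    scale [N], of that offset multiplied by [2 ^ (N - j)].  This turns a
    difference of positions on two scales into an integer label on the finer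
    grid, which is what a convolution can see. *)
Lemma dyadic_pointB N j j' (p q p' q' : nat) (k l i m : nat) :
  (j <= N)%N -> (j' <= N)%N ->
  p = (2 ^ (N - j') * k)%N -> q = (2 ^ (N - j') * l)%N ->
  p' = (2 ^ (N - j) * i)%N -> q' = (2 ^ (N - j) * m)%N ->
  (2 ^- N * (p%:Z - p'%:Z)%:~R, 2 ^- N * (q%:Z - q'%:Z)%:~R) =
  dyadic_point j' (k, l) - dyadic_point j (i, m).
Proof.
move=> jN j'N -> -> -> ->.
have e n r : (n <= N)%N -> 2 ^- N * (2 ^ (N - n) * r)%:R = 2 ^- n * r%:R :> R.
  move=> nN; rewrite natrM natrX mulrA; congr (_ * _).
  by rewrite -{1}(subnKC nN) exprD invfM mulfVK ?expf_neq0.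
by congr pair; rewrite /= rmorphB /= mulrBr !e.
Qed.

End Correlation.

(** * Upsampling and downsampling *)

Section Resampling.
Variable R : realType.

Lemma resizeE m n (e : m = n) (B : 'M[R]_m) k l :
  resize e B k l = B (cast_ord (esym e) k) (cast_ord (esym e) l).
Proof. exact: castmxE. Qed.

Lemma sum_double b (g : 'I_(b.*2) -> R) :
  (forall i : 'I_(b.*2), odd i -> g i = 0) ->
  \sum_i g i = \sum_(i < b) g (double_ord i).
Proof.
move=> g0; rewrite (bigID (fun i : 'I__ => odd i)) /= big1 ?add0r; last exact: g0.
rewrite (reindex_onto (@double_ord b) (@half_ord b)) /=.
  apply: eq_bigl => i; rewrite odd_double /=.
  by apply/eqP/val_inj; rewrite /= doubleK.
by move=> i /negbTE oi; apply/val_inj => /=; rewrite -[RHS]odd_double_half oi.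
Qed.

(** Upsampling is dual to sampling the other factor: the inserted zeros leave
    only the even positions in the sum.  The factor [F] is a function on nat so
    that it does not depend on the size of the matrix. *)
Lemma sum_upsample b (B : 'M[R]_b) (F : nat -> nat -> R) :
  \sum_(i < b.*2) \sum_(m < b.*2) F i m * upsample B i m =
  \sum_(i < b) \sum_(m < b) F i.*2 m.*2 * B i m.
Proof.
rewrite sum_double => [|i oi]; last by apply: big1 => m _; rewrite mxE oi mulr0.
apply: eq_bigr => i _.
rewrite sum_double => [|m om]; last by rewrite mxE om orbT mulr0.
apply: eq_bigr => m _; rewrite mxE /= !odd_double /=.
by congr (_ * B _ _); apply/val_inj; rewrite /= doubleK.
Qed.

Lemma sum_upsample_iter eta b (B : 'M[R]_b) (F : nat -> nat -> R) :
  \sum_(i < iter eta double b) \sum_(m < iter eta double b)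
    F i m * upsample_iter eta B i m =
  \sum_(i < b) \sum_(m < b) F (2 ^ eta * i)%N (2 ^ eta * m)%N * B i m.
Proof.
elim: eta F => [|eta IH] F /=.
  by under [RHS]eq_bigr do under eq_bigr do rewrite !mul1n.
rewrite sum_upsample (IH (fun i m => F i.*2 m.*2)).
apply: eq_bigr => i _; apply: eq_bigr => m _.
by rewrite -!mul2n !mulnA -expnS.
Qed.

Lemma downsample_iterE eta b (B : 'M[R]_(iter eta double b)) (k l : 'I_b) :
  exists p q : 'I_(iter eta double b),
    [/\ p = (2 ^ eta * k)%N :> nat, q = (2 ^ eta * l)%N :> nat
      & downsample_iter B k l = B p q].
Proof.
elim: eta B => [|eta IH] B /=; first by exists k, l; rewrite !mul1n.
have [p [q [pE qE ->]]] := IH (downsample B).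
exists (double_ord p), (double_ord q).
by rewrite mxE /= pE qE -!mul2n !mulnA -expnS.
Qed.

End Resampling.

Lemma scale_gapE j j' : scale_gap j j' = (maxn j j' - minn j j')%N.
Proof.
rewrite /scale_gap; case: (leqP j j') => h; first by rewrite subzn.
by rewrite distnC subzn // ltnW.
Qed.

(** * Block products and convolutions as double sums *)

Section DoubleSums.
Variable R : realType.

(** The size of [B] is kept as a separate index [n], so that the sums range
    over the size that [B] has before it is identified with the finer one. *)
Lemma mxconv_Ktilde (phi psi : R -> R) kappa j t j' t' n
    (e : n = (2 ^ maxn j j')%N) (B : 'M[R]_n) k l :
  mxconv (Ktilde phi psi kappa j t j' t') (resize e B) k l =
  \sum_(i < n) \sum_(m < n)
    correlation phi psi kappa j t j' t'
      (2 ^- maxn j j' * (k%:Z - i%:Z)%:~R,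
       2 ^- maxn j j' * (l%:Z - m%:Z)%:~R) * B i m.
Proof.
subst n; rewrite /resize castmx_id mxE.
apply: eq_bigr => i _; apply: eq_bigr => m _.
by rewrite mxE !centred_labelE.
Qed.

Lemma block_mulE J0 J (idx : windex J0 J -> 'I_(2 ^ (2 * J)))
    (K : 'M[R]_(2 ^ (2 * J))) (w : 'cV[R]_(2 ^ (2 * J)))
    j t (v : wavelet_valid J0 J j t)
    j' t' (v' : wavelet_valid J0 J j' t') k l :
  vec_mx (mxblock_to idx K v v' *m subvector idx w v)^T k l =
  \sum_(i < 2 ^ j) \sum_(m < 2 ^ j)
    K (idx (WIndex (k, l) v')) (idx (WIndex (i, m) v)) * reshaped idx w v i m.
Proof.
rewrite mxE mxE mxE.
rewrite (reindex (uncurry (@mxvec_index (2 ^ j) (2 ^ j)))); last first.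
  exact: curry_mxvec_bij.
rewrite pair_big; apply: eq_bigr => -[i m] _ /=.
by rewrite !mxE /block_idx !grid_offsetK.
Qed.

End DoubleSums.

(** * The block product as a resampled convolution *)

Theorem proposition3p1 (R : realType)
    (* X = L^2(Omega) *)
    (Omega : set (plane R)) (mOmega : measurable Omega)
    (* the Hilbert space Y *)
    (Y : completeNormedModType R) (dotY : {dot Y for idfun})
    (hY : forall y : Y, `|y| ^+ 2 = dotY y y)
    (* the bounded operator A and its adjoint *)
    (A : {linear L2 mOmega -> Y}) (hA : bounded_op A)
    (Astar : Y -> L2 mOmega) (hAstar : adjoint_op dotY A Astar)
    (* the wavelet basis *)
    (phi psi : R -> R)
    (hphi : forall x, phi x != 0 -> 0 <= x <= 1)
    (hpsi : forall x, psi x != 0 -> 0 <= x <= 1)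
    (J0 J : nat) (hJ : (J0 < J)%N)
    (idx : windex J0 J -> 'I_(2 ^ (2 * J))) (hidx : bijective idx)
    (Psi : windex J0 J -> L2 mOmega)
    (hPsi : forall I x, Psi I x = wavelet_at phi psi I x)
    (horth : forall I I', L2dot (Psi I) (Psi I') = (idx I == idx I')%:R)
    (* the matrix of A^* A and the convolution kernel *)
    (K : 'M[R]_(2 ^ (2 * J)))
    (ker : R * R -> R * R -> R) (kappa : R * R -> R)
    (hkappa : measurable_fun [set: plane R] kappa)
    (hker : forall x x', ker x x' = kappa (x - x'))
    (hKA : forall I I', K (idx I) (idx I') = L2dot (Astar (A (Psi I))) (Psi I'))
    (hKker : forall I I', L2dot (Astar (A (Psi I))) (Psi I') =
      dbl_int ker (wavelet_at phi psi I) (wavelet_at phi psi I'))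
    (w : 'cV[R]_(2 ^ (2 * J)))
    (j : nat) (t : wtype) (v : wavelet_valid J0 J j t)
    (j' : nat) (t' : wtype) (v' : wavelet_valid J0 J j' t') :
  let Kw := vec_mx (mxblock_to idx K v v' *m subvector idx w v)^T in
  let Kt := Ktilde phi psi kappa j t j' t' in
  let W := reshaped idx w v in
  let delta := scale_gap j j' in
  [/\ forall lt_jj' : (j < j')%N,
        Kw = resize (size_fine_row (ltnW lt_jj'))
               (mxconv Kt (resize (size_up lt_jj') (upsample_iter delta W))),
      forall eq_jj' : j = j',
        Kw = resize (size_fine_row (eq_leq eq_jj'))
               (mxconv Kt (resize (size_fine_col (eq_leq (esym eq_jj'))) W))
    & forall lt_j'j : (j' < j)%N,
        Kw = downsample_iter (resize (size_down lt_j'j)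
               (mxconv Kt (resize (size_fine_col (ltnW lt_j'j)) W)))].
Proof.
move=> Kw Kt W delta.
pose corr := correlation phi psi kappa j t j' t'.
have dotY_sym y z : dotY y z = dotY z y by rewrite hermC mul1r.
(* [Ktilde] attaches the (j, t) wavelet to the first variable of the kernel,
   whereas a row of the block has the (j', t') wavelet there.  The two agree
   because A^* A is self-adjoint. *)
have K_sym I I' : K (idx I) (idx I') = K (idx I') (idx I).
  have L2dotC (f g : L2 mOmega) : L2dot f g = L2dot g f.
    by apply: eq_Rintegral => x _; rewrite mulrC.
  by rewrite !hKA L2dotC [RHS]L2dotC -!hAstar dotY_sym.
have kerE : ker = fun x x' => kappa (x - x').
  by apply/funext => x; apply/funext => x'.
have KwE k l : Kw k l = \sum_(i < 2 ^ j) \sum_(m < 2 ^ j)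
    corr (dyadic_point R j' (k : nat, l : nat) -
          dyadic_point R j (i : nat, m : nat)) * W i m.
  rewrite /Kw block_mulE; apply: eq_bigr => i _; apply: eq_bigr => m _.
  by congr (_ * _); rewrite K_sym hKA hKker kerE dbl_int_wavelet.
have [jN j'N] : (j <= maxn j j')%N /\ (j' <= maxn j j')%N.
  by rewrite leq_maxl leq_maxr.
split=> h; apply/matrixP => k l; rewrite KwE.
- have fineE n : n = (2 ^ (maxn j j' - j') * n)%N.
    by rewrite (maxn_idPr (ltnW h)) subnn mul1n.
  have coarseE n : (2 ^ scale_gap j j' * n)%N = (2 ^ (maxn j j' - j) * n)%N.
    by rewrite scale_gapE (minn_idPl (ltnW h)).
  rewrite resizeE mxconv_Ktilde.
  pose F i m := corr (2 ^- maxn j j' * (k%:Z - i%:Z)%:~R,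
    2 ^- maxn j j' * (l%:Z - m%:Z)%:~R).
  apply/esym/(etrans (sum_upsample_iter _ W F))/esym.
  apply: eq_bigr => i _; apply: eq_bigr => m _.
  by rewrite -(dyadic_pointB R jN j'N (fineE k) (fineE l)
    (coarseE i) (coarseE m)).
- have fineE n : n = (2 ^ (maxn j j' - j) * n)%N.
    by rewrite -h maxnn subnn mul1n.
  have fineE' n : n = (2 ^ (maxn j j' - j') * n)%N.
    by rewrite -h maxnn subnn mul1n.
  rewrite resizeE mxconv_Ktilde.
  apply: eq_bigr => i _; apply: eq_bigr => m _.
  by rewrite -(dyadic_pointB R jN j'N (fineE' k) (fineE' l) (fineE i) (fineE m)).
- have fineE n : n = (2 ^ (maxn j j' - j) * n)%N.
    by rewrite (maxn_idPl (ltnW h)) subnn mul1n.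
  have coarseE n : (2 ^ scale_gap j j' * n)%N = (2 ^ (maxn j j' - j') * n)%N.
    by rewrite scale_gapE (minn_idPr (ltnW h)).
  have [p [q [pE qE ->]]] := downsample_iterE (resize (size_down h)
    (mxconv Kt (resize (size_fine_col (ltnW h)) W))) k l.
  rewrite resizeE mxconv_Ktilde.
  apply: eq_bigr => i _; apply: eq_bigr => m _.
  have pE' := etrans pE (coarseE k); have qE' := etrans qE (coarseE l).
  by rewrite -(dyadic_pointB R jN j'N pE' qE' (fineE i) (fineE m)).
Qed.
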